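(* Let $K$ be a nonempty subset of a metric space $(X,d)$ and let $T, f: K \to K$ be two mappings such that $\overline{T(K)} \subseteq f(K)$. Assume that for all $x, y \in K$, \[ d(Tx, Ty) \leq \varphi \Big( \max \big\{ d(fx, fy),\, d(Tx, fx),\, d(Ty, fy),\, \tfrac{1}{2}[d(Tx, fy) + d(Ty, fx)] \big\} \Big), \] where $\varphi: \mathbb{R}_{+} \to \mathbb{R}_{+}$ is a monotonically increasing and continuous function on $\mathbb{R}_{+}$ and $0 \leq \varphi(t) < t$ for $t > 0$. If either $\overline{T(K)}$ or $f(K)$ is complete and the pair of mappings $(T,f)$ is weakly compatible, then $F(T) \cap F(f)$ is a singleton.
   Context: Notation: $\mathbb{R}_{+} = [0,\infty)$; $\overline{A}$ denotes the closure of a set $A$ in $X$; for a self-map $S$ of $K$, $F(S) = \{x \in K : Sx = x\}$ is its set of fixed points. Two self-maps $S, h$ of $K$ are called weakly compatible if they commute at their coincidence points: for every $x \in K$, if $hx = Sx$ then $hSx = Shx$. Completeness of a subset of $X$ means completeness with respect to the restricted metric $d$. *)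

(* Defs.v *)
From HB Require Import structures.
From mathcomp Require Import all_boot all_order all_algebra.
From mathcomp Require Import all_classical all_reals all_analysis.

Set Implicit Arguments.
Unset Strict Implicit.
Unset Printing Implicit Defensive.

Import Order.TTheory GRing.Theory Num.Theory.
Import numFieldNormedType.Exports.

Local Open Scope classical_set_scope.
Local Open Scope ring_scope.

(* A self-map of K is a total function on the ambient type sending K to K,
   so everything below only inspects its values on K. *)

Definition fixed_points (X : Type) (K : set X) (S : X -> X) : set X :=
  [set x | K x /\ S x = x].

Definition weakly_compatible (X : Type) (K : set X) (S h : X -> X) : Prop :=
  forall x, K x -> h x = S x -> h (S x) = S (h x).

(* Completeness of A for the restricted metric: the limit must lie in A. *)
Definition complete_subset (R : realType) (X : metricType R) (A : set X) : Prop :=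
  forall u : nat -> X, (forall n, A (u n)) -> cauchy (u @ \oo) ->
    exists2 x, A x & u @ \oo --> x.

(* Main.v *)
(** A Jungck iteration [f x_(n+1) = T x_n], whose values [y_n = f x_n] satisfy
    the Ciric-type contraction estimate.  Continuity of [phi] together with
    [phi t < t] yields, for each [t > 0], some [e > 0] with
    [phi (t + e) < t]; this single gap gives successively that the steps
    [d(y_(n+1), y_n)] tend to [0], that [y] is Cauchy (a Meir-Keeler
    induction: once the steps are small, balls of radius [t] trap the orbit),
    and that the limit [w = f u] satisfies [T u = w].  Two coincidence points
    have the same image, and by weak compatibility [w] is again a coincidence
    point, so [T w = w = f w]. *)

Require Import Defs.
From mathcomp Require Import all_boot all_order all_algebra.
From mathcomp Require Import all_classical all_reals all_analysis.
From mathcomp Require Import lra.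

Import Order.TTheory GRing.Theory Num.Theory.
Import numFieldNormedType.Exports.

Local Open Scope classical_set_scope.
Local Open Scope ring_scope.

Lemma comparison_gap (R : realType) (phi : R -> R) :
  {within `[0, +oo[, continuous phi} ->
  (forall t, 0 < t -> phi t < t) ->
  forall t, 0 < t -> exists2 e, 0 < e & phi (t + e) < t.
Proof.
move=> /continuous_within_itvcyP[cphi _] phi_lt t t0.
have tin : t \in `]0, +oo[ by rewrite in_itv/= t0.
have : \forall s \near t, phi s < t.
  exact: cvgr_lt (cphi _ tin) _ (phi_lt _ t0).
case=> r /= r0 br; exists (r / 2); first by rewrite divr_gt0.
apply: br => /=; rewrite opprD addNKr normrN gtr0_norm ?divr_gt0//.
by rewrite ltr_pdivrMr// ltr_pMr// ltr1n.
Qed.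

Lemma comparison_lt (R : realType) (phi : R -> R) :
  {in `[0, +oo[ &, {homo phi : s t / s <= t}} ->
  (forall t, 0 < t -> exists2 e, 0 < e & phi (t + e) < t) ->
  forall t, 0 < t -> phi t < t.
Proof.
move=> phi_mono gap t t0; have [e e0] := gap t t0.
by apply: le_lt_trans; apply: phi_mono; rewrite ?in_itv/= ?andbT; lra.
Qed.

(** The steps decrease, hence approach their infimum; a positive infimum [r] is excluded because the
    gap at [r] pushes some step below [r]. In the contraction hypothesis, [m] is any common bound on
    the terms under the maximum. *)
Lemma orbit_step_small (R : realType) (X : metricType R) (phi : R -> R)
    (y : nat -> X) :
  (forall t, 0 < t -> phi t < t) ->
  (forall t, 0 < t -> exists2 e, 0 < e & phi (t + e) < t) ->
  (forall i j m, mdist (y i) (y j) <= m ->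
    mdist (y i.+1) (y i) <= m -> mdist (y j.+1) (y j) <= m ->
    mdist (y i.+1) (y j) + mdist (y j.+1) (y i) <= 2 * m ->
    mdist (y i.+1) (y j.+1) <= phi m) ->
  forall e, 0 < e ->
    exists N, forall n, (N <= n)%N -> mdist (y n.+1) (y n) < e.
Proof.
move=> phi_lt gap contr; pose d n := mdist (y n.+1) (y n).
(* Contraction at [i = n+1], [j = n]: one mixed distance vanishes and the other is at most
   [d n.+1 + d n]. *)
have step n m : d n <= m -> d n.+1 <= m -> d n.+1 <= phi m.
  move=> dn dn1; apply: contr => //; rewrite mdistxx addr0.
  have := metric_triangle (y n.+2) (y n.+1) (y n).
  by move: dn dn1; rewrite /d; lra.
have d_ge0 n : 0 <= d n by exact: mdist_ge0.
have dS n : d n.+1 <= d n.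
  rewrite leNgt; apply/negP => lt_d.
  have := step n _ (ltW lt_d) (lexx _); apply/negP; rewrite -ltNge.
  exact: phi_lt (le_lt_trans (d_ge0 n) lt_d).
have d_anti m n : (m <= n)%N -> d n <= d m.
  by apply: (nonincreasing_seqP d).1.
have hinf : has_inf (range d).
  by split; [exists (d 0%N), 0%N|exists 0 => _ [n _ <-]].
have inf_le n : inf (range d) <= d n by apply: ge_inf; [case: hinf|exists n].
have inf0 : inf (range d) <= 0.
  rewrite leNgt; apply/negP => r0; have [e e0 pe] := gap _ r0.
  have [_ [n _ <-] dn] := inf_adherent e0 hinf.
  have := step n _ (ltW dn) (le_trans (dS n) (ltW dn)).
  by have := inf_le n.+1; lra.
move=> e e0; have [_ [N _ <-] dN] := inf_adherent e0 hinf.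
by exists N => n /d_anti dn; rewrite -/(d n); lra.
Qed.

Lemma orbit_cauchy (R : realType) (X : metricType R) (phi : R -> R)
    (y : nat -> X) :
  {in `[0, +oo[ &, {homo phi : s t / s <= t}} ->
  (forall t, 0 < t -> exists2 e, 0 < e & phi (t + e) < t) ->
  (forall i j m, mdist (y i) (y j) <= m ->
    mdist (y i.+1) (y i) <= m -> mdist (y j.+1) (y j) <= m ->
    mdist (y i.+1) (y j) + mdist (y j.+1) (y i) <= 2 * m ->
    mdist (y i.+1) (y j.+1) <= phi m) ->
  cauchy (y @ \oo).
Proof.
move=> phi_mono gap contr; apply: cauchy_exP => t t0.
(* The trap below gives a non-strict bound, so half the radius is used to land in the open ball. *)
have t20 : 0 < t / 2 by rewrite divr_gt0.
have [e e0 pe] := gap _ t20.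
have phi_lt := @comparison_lt _ _ phi_mono gap.
(* [s <= e] keeps all distances for the pair [N], [N + k] within [t / 2 + e]; the other bound makes
   the step from [y N] to [y N.+1] plus [phi (t / 2 + e)] fit in [t / 2]. *)
set s := Num.min e (t / 2 - phi (t / 2 + e)).
have s0 : 0 < s by rewrite lt_min e0 subr_gt0.
have se : s <= e by rewrite ge_min lexx.
have sp : s <= t / 2 - phi (t / 2 + e) by rewrite ge_min lexx orbT.
have [N dN] := @orbit_step_small _ _ _ _ phi_lt gap contr _ s0.
have trap k : mdist (y N) (y (N + k)%N) <= t / 2.
  elim: k => [|k IH]; first by rewrite addn0 mdistxx ltW.
  have d0 := dN N (leqnn N); have dk := dN (N + k)%N (leq_addr k N).
  have tri0 := metric_triangle (y N) (y N.+1) (y (N + k).+1).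
  have tri1 := metric_triangle (y N.+1) (y N) (y (N + k)%N).
  have tri2 := metric_triangle (y (N + k).+1) (y (N + k)%N) (y N).
  have sym0 := metric_sym (y N) (y N.+1).
  have symk := metric_sym (y N) (y (N + k)%N).
  rewrite addnS.
  have : mdist (y N.+1) (y (N + k).+1) <= phi (t / 2 + e).
    by apply: contr; lra.
  by lra.
exists (y N); exists N => // n /= /subnKC <-.
by rewrite ballEmdist/=; have := trap (n - N)%N; lra.
Qed.

Theorem corollary3p4 (R : realType) (X : metricType R) (K : set X)
  (T f : {fun K >-> K}) (phi : {fun `[0 : R, +oo[ >-> `[0 : R, +oo[}) :
  K !=set0 ->
  closure (T @` K) `<=` f @` K ->
  {in `[0 : R, +oo[ &, {homo phi : s t / s <= t}} ->
  {within `[0 : R, +oo[, continuous phi} ->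
  (forall t : R, 0 < t -> 0 <= phi t < t) ->
  (forall x y : X, K x -> K y ->
    mdist (T x) (T y) <=
    phi (Num.max (mdist (f x) (f y))
        (Num.max (mdist (T x) (f x))
        (Num.max (mdist (T y) (f y))
                 (2^-1 * (mdist (T x) (f y) + mdist (T y) (f x))))))) ->
  complete_subset (closure (T @` K)) \/ complete_subset (f @` K) ->
  weakly_compatible K T f ->
  exists z : X, fixed_points K T `&` fixed_points K f = [set z].
Proof.
move=> [x0 Kx0] clTf phi_mono phi_cont phi_lt0 contr0 compl wc.
have phi_lt t : 0 < t -> phi t < t by move=> /phi_lt0/andP[].
have gap := @comparison_gap _ _ phi_cont phi_lt.
have KT x : K x -> K (T x) by exact: funS.
have contr x y m : K x -> K y -> mdist (f x) (f y) <= m ->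
    mdist (T x) (f x) <= m -> mdist (T y) (f y) <= m ->
    mdist (T x) (f y) + mdist (T y) (f x) <= 2 * m ->
    mdist (T x) (T y) <= phi m.
  move=> Kx Ky h1 h2 h3 h4; apply: le_trans (contr0 x y Kx Ky) _.
  apply: phi_mono; rewrite ?in_itv/= ?andbT.
  - by rewrite le_max mdist_ge0.
  - exact: le_trans (mdist_ge0 _ _) h1.
  - by rewrite !ge_max h1 h2 h3/=; lra.
(* With [m = d(Tu, Tv)] the self-distances vanish and the mixed sum is exactly [2 * m], so
   [m <= phi m], forcing [m = 0]. *)
have coincidence_eq u v : K u -> K v -> f u = T u -> f v = T v -> T u = T v.
  move=> Ku Kv fu fv; apply/eqP/negPn/negP; rewrite -mdist_gt0 => uv0.
  have := contr u v (mdist (T u) (T v)) Ku Kv.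
  rewrite fu fv !mdistxx (metric_sym (T v)) => /(_ (lexx _)).
  have := phi_lt _ uv0; set D := mdist _ _ in uv0 *.
  by move=> pD /(_ (ltW uv0) (ltW uv0)) H; have := H ltac:(lra); lra.
have clT x : K x -> closure (T @` K) (T x).
  by move=> Kx; apply: subset_closure; exists x.
have /choice[g gP] x : exists x', K x -> K x' /\ f x' = T x.
  have [/clT/clTf[x' Kx' fx']|nKx] := pselect (K x); first by exists x'.
  (* Junk value outside [K], never reached by the iteration. *)
  by exists x.
pose x n := iter n g x0.
have xK n : K (x n) by elim: n => // n /gP[].
have fx n : f (x n.+1) = T (x n) by have [] := gP _ (xK n).
(* Also [y n = f (x n.+1)], so the orbit estimate at [i], [j] is the contraction at [x i.+1],
   [x j.+1]. *)
pose y n := T (x n).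
have ycauchy : cauchy (y @ \oo).
  apply: (@orbit_cauchy _ _ phi) => // i j m; rewrite /y => h1 h2 h3 h4.
  by apply: contr; rewrite ?fx.
have [w [u Ku fu] yw] : exists2 w, (f @` K) w & y @ \oo --> w.
  have fy n : (f @` K) (y n) by apply: clTf; exact: clT.
  case: compl => [ct|cf]; last exact: cf.
  have [||w /clTf ? ?] := ct y => //; last by exists w.
  by move=> n; exact: clT.
have Tu : T u = w.
  apply/eqP/negPn/negP; rewrite -mdist_gt0 => a0.
  have [e e0 pe] := gap _ a0; set a := mdist (T u) w in a0 pe.
  (* Compare [u] with [x N.+1]: [y N] and [y N.+1] are both within [s] of [w], so their distance is
     at most [2 * s <= e]. The second bound yields [a < phi (a + e) + s <= a], a contradiction. *)
  set s := Num.min (e / 2) (a - phi (a + e)).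
  have s0 : 0 < s by rewrite lt_min divr_gt0//= subr_gt0.
  have se : s <= e / 2 by rewrite ge_min lexx.
  have sp : s <= a - phi (a + e) by rewrite ge_min lexx orbT.
  have [N _ yN] := cvg_ball yw s0.
  have := yN N (leqnn N); have := yN N.+1 (leqnSn N).
  rewrite !ballEmdist/= => y1 y0.
  have tri0 := metric_triangle (T u) (y N.+1) w.
  have tri1 := metric_triangle (T u) w (y N).
  have tri2 := metric_triangle (y N.+1) w (y N).
  have sym1 := metric_sym w (y N.+1).
  rewrite -/a in tri0 tri1.
  have : mdist (T u) (y N.+1) <= phi (a + e).
    by apply: contr => //; rewrite ?fx ?fu -/(y N) -/(y N.+1) -/a; lra.
  by lra.
have Kw : K w by rewrite -Tu; exact: KT.
have fuTu : f u = T u by rewrite fu Tu.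
have fwTw : f w = T w by have := wc u Ku fuTu; rewrite Tu fu.
have Tw : T w = w by rewrite -[RHS]Tu; exact: coincidence_eq.
exists w; apply/seteqP; split=> [z [[Kz Tz] [_ fz]]|_ ->] /=.
  (* A common fixed point is a coincidence point, so uniqueness follows from [coincidence_eq]. *)
  by rewrite -Tz -Tw; apply: coincidence_eq; rewrite ?fz ?Tz.
by split; split=> //; rewrite fwTw.
Qed.
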